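(* Let $$\langle X_1,H_\lambda,\lambda\in\Lambda\mid R=1,\ R\in\mathcal R_1\rangle\quad\text{and}\quad\langle X_2,H_\lambda,\lambda\in\Lambda\mid R=1,\ R\in\mathcal R_2\rangle$$ be two finite relative presentations of the same group $G$ with respect to a fixed collection of subgroups $\{H_\lambda\}_{\lambda\in\Lambda}$, and let $\delta_1$ and $\delta_2$ be the corresponding relative Dehn functions. Suppose that $\delta_1$ is well-defined, i.e., $\delta_1(n)$ is finite for every $n$. Then $\delta_2$ is well-defined and $\delta_1\sim\delta_2$.
   Context: A subset $X\subseteq G$ is a relative generating set of $G$ with respect to $\{H_\lambda\}_{\lambda\in\Lambda}$ if $G$ is generated by $X\cup\bigcup_{\lambda\in\Lambda}H_\lambda$. In this case put $F=(\ast_{\lambda\in\Lambda}\widetilde H_\lambda)\ast F(X)$, where $\widetilde H_\lambda$ is an isomorphic copy of $H_\lambda$ and $F(X)$ is the free group with basis $X$, let $\varepsilon:F\to G$ be the canonical epimorphism, and let $\mathcal H=\bigsqcup_{\lambda\in\Lambda}(\widetilde H_\lambda\setminus\{1\})$. $G$ has the relative presentation $\langle X, H_\lambda,\lambda\in\Lambda \mid R=1, R\in\mathcal R\rangle$, where $\mathcal R$ is a set of words over $X^{\pm1}\cup\mathcal H$ (viewed as elements of $F$, closed under cyclic shifts and inverses), if $\ker\varepsilon$ is the normal closure of $\mathcal R$ in $F$. It is finite if both $X$ and $\mathcal R$ are finite. A function $f:\mathbb N\to\mathbb N$ is a relative isoperimetric function of the presentation if for every $n$ and every word $W$ over $X^{\pm1}\cup\mathcal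 H$ of length at most $n$ representing $1$ in $G$, there is an equality $W=\prod_{i=1}^k f_i^{-1}R_if_i$ in $F$ with $R_i\in\mathcal R$, $f_i\in F$, $k\le f(n)$. The smallest relative isoperimetric function is the relative Dehn function of the presentation (it may take the value $\infty$, in which case it is said not to be well-defined). For $f,g:\mathbb N\to\mathbb N$ write $f\preceq g$ if there are constants $C,K,L\in\mathbb N$ such that $f(n)\le Cg(Kn)+Ln$ for all $n$, and $f\sim g$ if $f\preceq g$ and $g\preceq f$. *)

(* Defs.v *)
From HB Require Import structures.
From Stdlib Require Import Relation_Operators.
From mathcomp Require Import all_boot.
From mathcomp Require Import all_classical.

Set Implicit Arguments.
Unset Strict Implicit.
Unset Printing Implicit Defensive.

Local Open Scope classical_set_scope.
Local Open Scope quotient_scope.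
Local Open Scope group_scope.

Section Generation.
Variable G : groupType.

Definition generated_subgroup (A : set G) : set G :=
  [set g | forall S : groupClosed G, A `<=` [set` S] -> g \in S].

Definition normal_closure (A : set G) : set G :=
  [set g | forall S : groupClosed G,
     (forall x y, x \in S -> x ^ y \in S) -> A `<=` [set` S] -> g \in S].

End Generation.

Definition kernel (G K : groupType) (f : G -> K) : set G := [set g | f g = 1].

Section FreeProduct.
Variables (G : groupType) (L : Type) (H : L -> groupClosed G) (X : set G).

(* [Gen x true] is x and [Gen x false] is x^-1, as formal letters: they are
   distinct from all other letters even when the values in G coincide.
   [Per l h] is the copy in the l-th factor of the nontrivial h in [H l]. *)
Inductive letter :=
  | Gen of X & bool
  | Per (l : L) of {h : G | (h \in H l) && (h != 1)}.

HB.instance Definition _ := gen_eqMixin letter.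
HB.instance Definition _ := gen_choiceMixin letter.

Definition word := seq letter.

Lemma nontriv_inv (l : L) (h : G) :
  (h \in H l) && (h != 1) -> (h^-1 \in H l) && (h^-1 != 1).
Proof.
case/andP=> hH h1; rewrite gpredV hH /=.
by apply: contra h1 => /eqP e; rewrite -[h]invgK e invg1.
Qed.

Definition letter_inv (a : letter) : letter :=
  match a with
  | Gen x b => Gen x (~~ b)
  | Per l h => @Per l (exist _ (val h)^-1 (nontriv_inv (valP h)))
  end.

Definition word_inv (w : word) : word := rev (map letter_inv w).

Inductive word_step : word -> word -> Prop :=
  | step_gen (u v : word) (x : X) (b : bool) :
      word_step (u ++ [:: Gen x b; Gen x (~~ b)] ++ v) (u ++ v)
  | step_mul (u v : word) (l : L)
      (h h' k : {h : G | (h \in H l) && (h != 1)}) :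
      val h * val h' = val k ->
      word_step (u ++ [:: Per h; Per h'] ++ v) (u ++ Per k :: v)
  | step_one (u v : word) (l : L)
      (h h' : {h : G | (h \in H l) && (h != 1)}) :
      val h * val h' = 1 ->
      word_step (u ++ [:: Per h; Per h'] ++ v) (u ++ v).

Definition word_equiv : word -> word -> Prop := clos_refl_sym_trans word word_step.

Definition word_eqb (u v : word) : bool := `[< word_equiv u v >].

Lemma word_eqb_refl : reflexive word_eqb.
Proof. by move=> u; apply/asboolP; apply: rst_refl. Qed.

Lemma word_eqb_sym : symmetric word_eqb.
Proof. by move=> u v; apply: asbool_equiv_eq; split; apply: rst_sym. Qed.

Lemma word_eqb_trans : transitive word_eqb.
Proof.
by move=> u v w /asboolP vu /asboolP uw; apply/asboolP; apply: rst_trans vu uw.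
Qed.

Canonical word_equiv_rel :=
  EquivRel word_eqb word_eqb_refl word_eqb_sym word_eqb_trans.

(* The group F, the free product of copies of the [H l] and of the free group
   with basis X: words modulo free cancellation and multiplication inside each
   factor. See [lift] below for its universal property. *)
Definition freeprod : Type := {eq_quot word_equiv_rel}.

HB.instance Definition _ := Choice.on freeprod.

Definition to_F (w : word) : freeprod := \pi_{eq_quot word_equiv_rel} w.

Lemma to_F_eq (u v : word) : to_F u = to_F v <-> word_equiv u v.
Proof.
by split=> [/eqmodP/asboolP //|uv]; apply/eqmodP/asboolP.
Qed.

Lemma to_F_surj (f : freeprod) : exists w, f = to_F w.
Proof. by exists (repr (f : {eq_quot word_equiv_rel})); rewrite /to_F reprK. Qed.

Lemma word_step_cat (p q u v : word) :
  word_step u v -> word_step (p ++ u ++ q) (p ++ v ++ q).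
Proof.
case=> [u' v' x b|u' v' l h h' k e|u' v' l h h' e]; rewrite -!catA /= !(catA p).
- exact: step_gen.
- exact: (step_mul _ _ e).
- exact: (step_one _ _ e).
Qed.

Lemma word_equiv_cat (u u' v v' : word) :
  word_equiv u u' -> word_equiv v v' -> word_equiv (u ++ v) (u' ++ v').
Proof.
move=> uu' vv'; apply: (@rst_trans _ _ _ (u' ++ v)).
  elim: uu' => {u u'} [u u'|u|u u' _|u u' u'' _ + _].
  - by move=> /(@word_step_cat [::] v); apply: rst_step.
  - exact: rst_refl.
  - exact: rst_sym.
  - exact: rst_trans.
elim: vv' => {v v'} [v v'|v|v v' _|v v' v'' _ + _].
- by move=> /(@word_step_cat u' [::]); rewrite !cats0; apply: rst_step.
- exact: rst_refl.
- exact: rst_sym.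
- exact: rst_trans.
Qed.

Lemma letter_invK : involutive letter_inv.
Proof.
case=> [x b|l h] /=; first by rewrite negbK.
by congr Per; apply: val_inj; rewrite /= invgK.
Qed.

Lemma word_invK : involutive word_inv.
Proof. by move=> w; rewrite /word_inv map_rev revK (mapK letter_invK). Qed.

Lemma word_inv_cat (u v : word) : word_inv (u ++ v) = word_inv v ++ word_inv u.
Proof. by rewrite /word_inv map_cat rev_cat. Qed.

Lemma letter_step (a : letter) : word_step [:: a; letter_inv a] [::].
Proof.
case: a => [x b|l h] /=; first exact: (@step_gen [::] [::]).
by apply: (@step_one [::] [::]); rewrite /= mulgV.
Qed.

Lemma word_mulV (w : word) : word_equiv (w ++ word_inv w) [::].
Proof.
elim: w => [|a w IH]; first exact: rst_refl.
rewrite /word_inv /= rev_cons -cats1 -/(word_inv w) catA.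
apply: (@rst_trans _ _ _ ([:: a] ++ [::] ++ [:: letter_inv a])).
  apply: (word_equiv_cat (u := [:: a]) (u' := [:: a])); first exact: rst_refl.
  by apply: word_equiv_cat => //; apply: rst_refl.
exact/rst_step/letter_step.
Qed.

Lemma word_Vmul (w : word) : word_equiv (word_inv w ++ w) [::].
Proof. by have := word_mulV (word_inv w); rewrite word_invK. Qed.

Lemma word_equiv_inv (u v : word) :
  word_equiv u v -> word_equiv (word_inv u) (word_inv v).
Proof.
move=> uv; apply: (@rst_trans _ _ _ (word_inv u ++ (v ++ word_inv v))).
  rewrite -{1}[word_inv u]cats0; apply: word_equiv_cat; first exact: rst_refl.
  exact/rst_sym/word_mulV.
rewrite catA.
apply: (word_equiv_cat (u' := [::]) (v' := word_inv v)); last exact: rst_refl.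
apply: rst_trans (word_Vmul u).
by apply: word_equiv_cat; [exact: rst_refl|exact: rst_sym].
Qed.

Definition F_repr (f : freeprod) : word := repr (f : {eq_quot word_equiv_rel}).

Lemma F_reprK (f : freeprod) : to_F (F_repr f) = f.
Proof. by rewrite /to_F /F_repr reprK. Qed.

Lemma F_repr_equiv (w : word) : word_equiv (F_repr (to_F w)) w.
Proof. by apply/to_F_eq; rewrite F_reprK. Qed.

Definition F_mul (f g : freeprod) : freeprod := to_F (F_repr f ++ F_repr g).
Definition F_inv (f : freeprod) : freeprod := to_F (word_inv (F_repr f)).
Definition F_one : freeprod := to_F [::].

Lemma F_mulE (u v : word) : F_mul (to_F u) (to_F v) = to_F (u ++ v).
Proof. by apply/to_F_eq; apply: word_equiv_cat; apply: F_repr_equiv. Qed.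

Lemma F_invE (w : word) : F_inv (to_F w) = to_F (word_inv w).
Proof. by apply/to_F_eq; apply: word_equiv_inv; apply: F_repr_equiv. Qed.

Lemma F_mulA : associative F_mul.
Proof.
move=> f g h; case: (to_F_surj f) (to_F_surj g) (to_F_surj h).
by move=> u -> [v ->] [w ->]; rewrite !F_mulE catA.
Qed.

Lemma F_mul1 : left_id F_one F_mul.
Proof. by move=> f; case: (to_F_surj f) => u ->; rewrite F_mulE. Qed.

Lemma F_mulr1 : right_id F_one F_mul.
Proof. by move=> f; case: (to_F_surj f) => u ->; rewrite F_mulE cats0. Qed.

Lemma F_mulV : left_inverse F_one F_inv F_mul.
Proof.
move=> f; case: (to_F_surj f) => u ->; rewrite F_invE F_mulE.
exact/to_F_eq/word_Vmul.
Qed.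

Lemma F_mulrV : right_inverse F_one F_inv F_mul.
Proof.
move=> f; case: (to_F_surj f) => u ->; rewrite F_invE F_mulE.
exact/to_F_eq/word_mulV.
Qed.

HB.instance Definition _ :=
  isGroup.Build freeprod F_mulA F_mul1 F_mulr1 F_mulV F_mulrV.

Lemma to_F_cat (u v : word) : to_F (u ++ v) = to_F u * to_F v.
Proof. by rewrite -F_mulE. Qed.

Section Lift.
Variables (K : groupType) (fx : X -> K) (fh : L -> G -> K).

Definition lift_letter (a : letter) : K :=
  match a with
  | Gen x b => if b then fx x else (fx x)^-1
  | Per l h => fh l (val h)
  end.

Definition lift_word (w : word) : K := \prod_(a <- w) lift_letter a.

Definition lift (f : freeprod) : K := lift_word (F_repr f).

Hypothesis fhM : forall l, {in H l &, {morph fh l : x y / x * y}}.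

Lemma lift_word_cat (u v : word) :
  lift_word (u ++ v) = lift_word u * lift_word v.
Proof. exact: big_cat. Qed.

Lemma lift_word_step (u v : word) : word_step u v -> lift_word u = lift_word v.
Proof.
have fh1 l : fh l 1 = 1.
  by apply: (mulgI (fh l 1)); rewrite -fhM ?gpred1 // !mulg1.
case=> [p q x b|p q l h h' k e|p q l h h' e]; rewrite !lift_word_cat.
- rewrite /lift_word !big_cons big_nil mulg1 /=.
  by case: b; rewrite /= ?mulgV ?mulVg mul1g.
- rewrite -cat1s lift_word_cat /lift_word !big_cons !big_nil !mulg1 /= -fhM ?e //.
    by case/andP: (valP h).
  by case/andP: (valP h').
- rewrite /lift_word !big_cons !big_nil !mulg1 /= -fhM ?e ?fh1 ?mul1g //.
    by case/andP: (valP h).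
  by case/andP: (valP h').
Qed.

Lemma lift_to_F (w : word) : lift (to_F w) = lift_word w.
Proof.
have lift_equiv u v : word_equiv u v -> lift_word u = lift_word v.
  elim=> {u v} [u v||u v _ ->|u v t _ -> _ ->] //; exact: lift_word_step.
exact/lift_equiv/F_repr_equiv.
Qed.

Lemma liftM : {morph lift : f g / f * g}.
Proof.
move=> f g; case: (to_F_surj f) (to_F_surj g) => u -> [v ->].
by rewrite -to_F_cat !lift_to_F lift_word_cat.
Qed.

Lemma lift_unique (phi : {multiplicative freeprod -> K}) :
  (forall a, phi (to_F [:: a]) = lift_letter a) -> phi =1 lift.
Proof.
move=> phiE f; case: (to_F_surj f) => w ->; rewrite lift_to_F.
have phi1 : phi (to_F [::]) = 1.
  by apply: (mulgI (phi (to_F [::]))); rewrite -gmulfM -to_F_cat mulg1.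
elim: w => [|a w IH]; first by rewrite phi1 /lift_word big_nil.
by rewrite -cat1s to_F_cat gmulfM IH phiE /lift_word big_cons.
Qed.

End Lift.

Definition eps : freeprod -> G := lift val (fun _ h => h).

Lemma epsM : {morph eps : f g / f * g}.
Proof. by apply: liftM. Qed.

Lemma eps1 : eps 1 = 1.
Proof. by apply: (mulgI (eps 1)); rewrite -epsM !mulg1. Qed.

HB.instance Definition _ := isUMagmaMorphism.Build freeprod G eps (eps1, epsM).

End FreeProduct.

(* The sets of relators consist of words; the closure conditions are therefore
   conditions on words, and finiteness is finiteness of the set of words. *)
Record rel_presentation (G : groupType) (L : Type) (H : L -> groupClosed G) :=
  RelPresentation {
    gens : set G;
    rels : set (word H gens);
    gens_generate :
      generated_subgroup (gens `|` \bigcup_l [set` H l]) = setT;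
    rels_cyclic : forall u v, rels (u ++ v) -> rels (v ++ u);
    rels_inv : forall w, rels w -> rels (word_inv w);
    rels_kernel :
      kernel (@eps G L H gens) = normal_closure (@to_F G L H gens @` rels)
  }.

Arguments rels {G L H} r w.

Definition finite_presentation (G : groupType) (L : Type)
    (H : L -> groupClosed G) (P : rel_presentation H) : Prop :=
  finite_set (gens P) /\ finite_set (rels P).

Section Dehn.
Variables (G : groupType) (L : Type) (H : L -> groupClosed G).
Variable P : rel_presentation H.

Definition conj_product (W : word H (gens P)) (k : nat) : Prop :=
  exists (R : 'I_k -> word H (gens P)) (f : 'I_k -> freeprod H (gens P)),
    (forall i, rels P (R i)) /\
    to_F W = \prod_(i < k) ((f i)^-1 * to_F (R i) * f i).

Definition area_bound (n m : nat) : Prop :=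
  forall W : word H (gens P), (size W <= n)%N -> eps (to_F W) = 1 ->
    exists2 k, (k <= m)%N & conj_product W k.

(* Functions with values in the natural numbers extended by infinity are coded
   in [option nat], infinity being [None]. At an infinite value there is no
   condition: every word representing 1 is a product of conjugates of
   relators, as the kernel of [eps] is the normal closure of the relators. *)
Definition isoperimetric (f : nat -> option nat) : Prop :=
  forall n m, f n = Some m -> area_bound n m.

Definition le_infty (a b : option nat) : Prop :=
  match a, b with
  | _, None => True
  | None, Some _ => False
  | Some m, Some m' => (m <= m')%N
  end.

Definition dehn (n : nat) : option nat :=
  if pselect (exists m, `[< area_bound n m >]) is left ex
  then Some (ex_minn ex) else None.

Lemma dehn_smallest :
  isoperimetric dehn /\
  forall f, isoperimetric f -> forall n, le_infty (dehn n) (f n).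
Proof.
split=> [n m|f fP n]; rewrite /dehn.
  by case: pselect => // ex [<-]; case: ex_minnP => k /asboolP.
case fn: (f n) => [m|]; last by case: pselect.
have /asboolP bm := fP _ _ fn.
case: pselect => [ex|[]]; last by exists m.
by case: ex_minnP => k _; apply.
Qed.

End Dehn.

Definition well_defined (d : nat -> option nat) : Prop :=
  forall n, exists m, d n = Some m.

(* Only meaningful when [well_defined d]. *)
Definition finite_values (d : nat -> option nat) (n : nat) : nat :=
  odflt 0%N (d n).

Definition dominated (f g : nat -> nat) : Prop :=
  exists C K L : nat, forall n, (f n <= C * g (K * n) + L * n)%N.

Definition equivalent (f g : nat -> nat) : Prop :=
  dominated f g /\ dominated g f.

(* Main.v *)
(* Rewriting the generators of one presentation as words in the generators of
   the other gives homomorphisms [phi : F2 -> F1] and [psi : F1 -> F2] over [G]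
   that fix the letters from the subgroups.  If [W] has length [n] and represents
   1, then [phi W] has length at most [K n], hence is a product of [m] conjugates
   of relators of the first presentation.  Applying [psi], each of the finitely
   many relators becomes a product of at most [C] conjugates of relators of the
   second one, so [psi (phi W)] needs at most [C m] of them; finally
   [W^-1 psi (phi W)] needs at most [L n], a bounded number for each letter. *)
From HB Require Import structures.
From Stdlib Require Import Relation_Operators.
Require Import Defs.
From mathcomp Require Import all_boot.
From mathcomp Require Import all_classical.

Set Implicit Arguments.
Unset Strict Implicit.
Unset Printing Implicit Defensive.

Local Open Scope classical_set_scope.
Local Open Scope group_scope.

(** Generated subgroups and normal closures quantify over bundled subgroups; this bundles a subgroup
    given by a property. *)
Lemma group_closed_pred (G : groupType) (S : {pred G}) :
  group_closed S -> exists S' : groupClosed G, S' =i S.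
Proof.
move=> SG.
pose S1 := isMul1Closed.Build G S SG.1.
pose SM := isMulClosed.Build G S (group_closedM SG).
pose SV := isInvClosed.Build G S (group_closedV SG).
by exists (HB.pack S S1 SM SV : groupClosed G).
Qed.

(** * Products of boundedly many conjugates *)

Section ConjugateProducts.
Variable F : groupType.
Implicit Types (A : set F) (x y : F) (m k : nat).

(* The index only bounds the number of factors, thanks to [conj_prod1]. *)
Inductive conj_prod A : nat -> F -> Prop :=
  | conj_prod1 m : conj_prod A m 1
  | conj_prodS m a g x : A a -> conj_prod A m x -> conj_prod A m.+1 (a ^ g * x).

Lemma conj_prod_leq A m k x : (m <= k)%N -> conj_prod A m x -> conj_prod A k x.
Proof.
move=> + cx; elim: cx k => {m x} [m k _|m a g x Aa _ IH [//|k] mk].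
  exact: conj_prod1.
by apply: conj_prodS => //; apply: IH.
Qed.

Lemma conj_prodM A m k x y :
  conj_prod A m x -> conj_prod A k y -> conj_prod A (m + k) (x * y).
Proof.
move=> cx cy; elim: cx => {m x} [m|m a g x Aa _ IH].
  by rewrite mul1g; apply: conj_prod_leq cy; apply: leq_addl.
by rewrite addSn -mulgA; apply: conj_prodS.
Qed.

Lemma conj_prod_gen A a : A a -> conj_prod A 1 a.
Proof.
move=> Aa; rewrite -[a]mulg1 -{1}[a]conjg1.
exact/conj_prodS/conj_prod1.
Qed.

Lemma conj_prodJ A m x y : conj_prod A m x -> conj_prod A m (x ^ y).
Proof.
elim=> {m x} [m|m a g x Aa _ IH]; first by rewrite conj1g; apply: conj_prod1.
by rewrite conjMg -conjgM; apply: conj_prodS.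
Qed.

Lemma conj_prodV A m x :
  (forall a, A a -> A a^-1) -> conj_prod A m x -> conj_prod A m x^-1.
Proof.
move=> AV; elim=> {m x} [m|m a g x Aa _ IH].
  by rewrite invg1; apply: conj_prod1.
rewrite invgM -conjVg -addn1; apply: conj_prodM => //.
exact/conj_prodJ/conj_prod_gen/AV.
Qed.

(** Products of conjugates of elements of [A] form a normal subgroup containing [A]; inverses stay
    inside because [A] is closed under them. *)
Lemma normal_closure_conj_prod A x :
  (forall a, A a -> A a^-1) -> normal_closure A x -> exists m, conj_prod A m x.
Proof.
move=> AV Ax; pose S : {pred F} := fun y => `[< exists m, conj_prod A m y >].
have SP y : reflect (exists m, conj_prod A m y) (y \in S) by apply: asboolP.
have SG : group_closed S.
  split; first by apply/SP; exists 0%N; apply: conj_prod1.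
  move=> y z /SP[m cy] /SP[k cz]; apply/SP; exists (m + k)%N.
  exact/conj_prodM/conj_prodV.
have [S' SE] := group_closed_pred SG.
apply/SP; rewrite -SE; apply: Ax => [y z|a Aa].
  by rewrite !SE => /SP[m cy]; apply/SP; exists m; apply: conj_prodJ.
by rewrite /= SE; apply/SP; exists 1%N; apply: conj_prod_gen.
Qed.

End ConjugateProducts.

Lemma morph_mul1 (F F' : groupType) (f : F -> F') :
  {morph f : x y / x * y} -> f 1 = 1.
Proof. by move=> fM; apply: (mulgI (f 1)); rewrite -fM !mulg1. Qed.

Lemma morph_mulV (F F' : groupType) (f : F -> F') :
  {morph f : x y / x * y} -> {morph f : x / x^-1}.
Proof.
by move=> fM x; apply: (mulgI (f x)); rewrite -fM !mulgV (morph_mul1 fM).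
Qed.

(** A factor [a ^ g] goes to [f a ^ f g], which costs at most [C] factors since conjugation
    preserves the count. *)
Lemma conj_prod_morph (F F' : groupType) (f : F -> F') (A : set F)
    (B : set F') (C m : nat) (x : F) :
  {morph f : x y / x * y} -> (forall a, A a -> conj_prod B C (f a)) ->
  conj_prod A m x -> conj_prod B (C * m) (f x).
Proof.
move=> fM AB; elim=> {m x} [m|m a g x Aa _ IH].
  by rewrite (morph_mul1 fM); apply: conj_prod1.
rewrite fM mulnS; apply: conj_prodM IH.
by rewrite conjgE !fM (morph_mulV fM) -conjgE; apply/conj_prodJ/AB.
Qed.

(** * Uniform bounds over finite sets *)

Lemma finite_uniform_bound (T : choiceType) (A : set T)
    (B : T -> nat -> Prop) :
  finite_set A -> (forall x m k, (m <= k)%N -> B x m -> B x k) ->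
  (forall x, A x -> exists m, B x m) -> exists m, forall x, A x -> B x m.
Proof.
move=> /finite_seqP[s ->] mono; elim: s => [|a s IH] ex; first by exists 0%N.
have [m ms] : exists m, forall x, [set` s] x -> B x m.
  by apply: IH => x /= xs; apply: ex; rewrite /= inE xs orbT.
have [k ka] : exists k, B a k by apply: ex; rewrite /= inE eqxx.
exists (m + k)%N => x /=; rewrite inE => /predU1P[->|xs].
  by apply: mono ka; apply: leq_addl.
by apply: mono (ms _ xs); apply: leq_addr.
Qed.

Lemma finite_set_type_bound (T : choiceType) (A : set T)
    (B : A -> nat -> Prop) :
  finite_set A -> (forall x m k, (m <= k)%N -> B x m -> B x k) ->
  (forall x, exists m, B x m) -> exists m, forall x, B x m.
Proof.
move=> fA mono ex.
(* Finiteness concerns elements of [T], while [B] takes elements of the subtype, so the bound is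
   stated for all [x] lying over [t]. *)
have [m Bm] : exists m, forall t, A t -> forall x : A, val x = t -> B x m.
  apply: finite_uniform_bound fA _ _ => [t m k mk + x xt|t At].
    by move=> /(_ x xt); apply: mono.
  have [m Bm] := ex (SigSub (mem_set At)).
  by exists m => x xt; rewrite (_ : x = SigSub (mem_set At)) //; apply: val_inj.
by exists m => x; apply: (Bm (val x)) => //; apply/set_mem/valP.
Qed.

(** * Words in the free product and their values in [G] *)

Section FreeProductWords.
Variables (G : groupType) (L : Type) (H : L -> groupClosed G) (X : set G).

Lemma to_F_nil : to_F [::] = 1 :> freeprod H X.
Proof. by []. Qed.

Lemma to_F_inv (w : word H X) : to_F (word_inv w) = (to_F w)^-1.
Proof. by rewrite -F_invE. Qed.

Lemma size_word_inv (w : word H X) : size (word_inv w) = size w.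
Proof. by rewrite size_rev size_map. Qed.

Lemma epsV : {morph @eps G L H X : f / f^-1}.
Proof. exact/morph_mulV/epsM. Qed.

Lemma eps_to_F1 (a : letter H X) :
  eps (to_F [:: a]) = lift_letter val (fun _ h => h) a.
Proof. by rewrite /eps lift_to_F // /lift_word big_cons big_nil mulg1. Qed.

(** The values of words form a subgroup containing [X] and every [H l]. *)
Lemma eps_surj (g : G) :
  generated_subgroup (X `|` \bigcup_l [set` H l]) = setT ->
  exists w : word H X, eps (to_F w) = g.
Proof.
move=> genG.
pose S : {pred G} := fun g => `[< exists w : word H X, eps (to_F w) = g >].
have SP y : reflect (exists w : word H X, eps (to_F w) = y) (y \in S).
  exact: asboolP.
have SG : group_closed S.
  split; first by apply/SP; exists [::]; rewrite to_F_nil eps1.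
  move=> _ _ /SP[u <-] /SP[v <-]; apply/SP; exists (u ++ word_inv v).
  by rewrite to_F_cat to_F_inv epsM epsV.
have [S' SE] := group_closed_pred SG.
have : generated_subgroup (X `|` \bigcup_l [set` H l]) g by rewrite genG.
move=> /(_ S') gS; apply/SP; rewrite -SE; apply: gS.
move=> x [Xx|[l _ /= lx]]; rewrite /= SE; apply/SP.
  by exists [:: Gen H (SigSub (mem_set Xx)) true]; rewrite eps_to_F1.
have [->|x1] := eqVneq x 1; first by exists [::]; rewrite to_F_nil eps1.
have lx1 : (x \in H l) && (x != 1) by rewrite lx.
by exists [:: Per X (exist _ x lx1)]; rewrite eps_to_F1.
Qed.

(** The embedding of [H l] into the free product, made total on [G] as [lift] requires: 1 is not a
    letter and goes to 1, as do elements outside [H l]. *)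
Definition per_letter (l : L) (h : G) : freeprod H X :=
  if insub h is Some h' then to_F [:: @Per G L H X l h'] else 1.

Lemma per_letter_val l (h : {h : G | (h \in H l) && (h != 1)}) :
  per_letter l (val h) = to_F [:: Per X h].
Proof. by rewrite /per_letter valK. Qed.

Lemma per_letter1 l : per_letter l 1 = 1.
Proof. by rewrite /per_letter insubF // eqxx andbF. Qed.

Lemma per_letterM l : {in H l &, {morph per_letter l : x y / x * y}}.
Proof.
move=> x y lx ly.
have [->|x1] := eqVneq x 1; first by rewrite per_letter1 !mul1g.
have [->|y1] := eqVneq y 1; first by rewrite per_letter1 !mulg1.
have lx1 : (x \in H l) && (x != 1) by rewrite lx.
have ly1 : (y \in H l) && (y != 1) by rewrite ly.
pose hx : {h : G | (h \in H l) && (h != 1)} := exist _ x lx1.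
pose hy : {h : G | (h \in H l) && (h != 1)} := exist _ y ly1.
rewrite (per_letter_val hx) (per_letter_val hy) -to_F_cat.
have [xy1|xy1] := eqVneq (x * y) 1.
  rewrite xy1 per_letter1 -to_F_nil; apply/to_F_eq/rst_sym/rst_step.
  exact: (@step_one _ _ _ _ [::] [::] l hx hy).
have lxy1 : (x * y \in H l) && (x * y != 1) by rewrite gpredM.
rewrite (per_letter_val (exist _ (x * y) lxy1)); apply/to_F_eq/rst_sym/rst_step.
exact: (@step_mul _ _ _ _ [::] [::] l hx hy).
Qed.

End FreeProductWords.

(** * Homomorphisms induced by rewriting generators *)

Section Substitution.
Variables (G : groupType) (L : Type) (H : L -> groupClosed G) (X Y : set G).
Variable s : X -> word H Y.

(** Both [phi] and [psi] of the outline have this form. *)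
Definition subst : freeprod H X -> freeprod H Y :=
  Defs.lift (fun x => to_F (s x)) (@per_letter G L H Y).

Lemma substM : {morph subst : f g / f * g}.
Proof. by apply: liftM => l; apply: per_letterM. Qed.

Lemma subst_letter (a : letter H X) :
  subst (to_F [:: a]) = lift_letter (fun x => to_F (s x)) (@per_letter G L H Y) a.
Proof.
rewrite /subst lift_to_F; last by move=> l; apply: per_letterM.
by rewrite /lift_word big_cons big_nil mulg1.
Qed.

Lemma subst_Per l (h : {h : G | (h \in H l) && (h != 1)}) :
  subst (to_F [:: Per X h]) = to_F [:: Per Y h].
Proof. by rewrite subst_letter -per_letter_val. Qed.

Lemma eps_subst :
  (forall x, eps (to_F (s x)) = val x) -> forall f, eps (subst f) = eps f.
Proof.
move=> sE f; case: (to_F_surj f) => w ->.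
elim: w => [|a w IH]; first by rewrite !to_F_nil (morph_mul1 substM) !eps1.
rewrite -cat1s to_F_cat substM !epsM IH eps_to_F1; congr (_ * _).
case: a => [x b|l h]; last by rewrite subst_Per eps_to_F1.
by rewrite subst_letter /=; case: b; rewrite ?epsV sE.
Qed.

(** Length makes sense for words only, hence the representative [w']. Letters from the subgroups
    keep length 1, hence [0 < K]. *)
Lemma subst_size (K : nat) (w : word H X) :
  (0 < K)%N -> (forall x, (size (s x) <= K)%N) ->
  exists2 w', subst (to_F w) = to_F w' & (size w' <= K * size w)%N.
Proof.
move=> K0 sK; elim: w => [|a w [w' wE szw']].
  by exists [::] => //; rewrite !to_F_nil (morph_mul1 substM).
have [u uE szu] : exists2 u, subst (to_F [:: a]) = to_F u & (size u <= K)%N.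
  case: a => [x b|l h]; last by exists [:: Per Y h]; rewrite ?subst_Per.
  rewrite subst_letter /=; case: b; first by exists (s x).
  by exists (word_inv (s x)); rewrite ?to_F_inv ?size_word_inv.
exists (u ++ w'); first by rewrite -cat1s !to_F_cat substM uE wE.
by rewrite size_cat mulnS leq_add.
Qed.

End Substitution.

(** * Comparison of areas and Dehn functions *)

Section Area.
Variables (G : groupType) (L : Type) (H : L -> groupClosed G).
Implicit Type P : rel_presentation H.

Local Notation relators P := (@to_F G L H (gens P) @` rels P).

Lemma relators_inv P a : relators P a -> relators P a^-1.
Proof.
case=> w Rw <-; exists (word_inv w); last exact: to_F_inv.
exact: rels_inv.
Qed.

Lemma kernel_conj_prod P (f : freeprod H (gens P)) :
  eps f = 1 -> exists m, conj_prod (relators P) m f.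
Proof.
move=> f1; apply: normal_closure_conj_prod; first exact: relators_inv.
by rewrite -rels_kernel.
Qed.

Lemma conj_productP P (W : word H (gens P)) m :
  (exists2 k, (k <= m)%N & conj_product W k) <->
  conj_prod (relators P) m (to_F W).
Proof.
split=> [[k km [R [f [RP ->]]]]|].
  apply: conj_prod_leq km _; elim: k R f RP => [|k IH] R f RP.
    by rewrite big_ord0; apply: conj_prod1.
  rewrite big_ord_recl -[_ * f ord0]mulgA -conjgE.
  apply: conj_prodS; last exact: IH.
  by exists (R ord0).
rewrite /conj_product; elim=> {m} [m|m _ g x [r Rr <-] _ [k km [R [f [RP ->]]]]].
  exists 0%N => //; exists (fun=> [::]), (fun=> 1).
  by split=> [[]|] //; rewrite big_ord0.
(* The new factor takes index 0 and the old ones are shifted by one. *)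
exists k.+1 => //; exists (fun i => oapp R r (unlift ord0 i)).
exists (fun i => oapp f g (unlift ord0 i)); split=> [i|].
  by case: unliftP => [j|] _ //=.
rewrite big_ord_recl unlift_none conjgE -!mulgA; do 3!congr (_ * _).
by apply: eq_bigr => i _; rewrite liftK -!mulgA.
Qed.

Lemma area_boundP P n m :
  area_bound P n m <-> forall W : word H (gens P), (size W <= n)%N ->
    eps (to_F W) = 1 -> conj_prod (relators P) m (to_F W).
Proof. by split=> b W szW W1; apply/conj_productP/b. Qed.

(** The constants are uniform in [n] and [m]: [K] and [M] come from the finitely many generators of
    [P2], [C] from the finitely many relators of [P1]. *)
Lemma area_bound_transfer (P1 P2 : rel_presentation H) :
  finite_set (gens P2) -> finite_set (rels P1) ->
  exists C K M, forall n m,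
    area_bound P1 (K * n) m -> area_bound P2 n (C * m + M * n).
Proof.
move=> fX2 fR1.
have [s1 s1E] := choice (fun x : gens P1 =>
  @eps_surj G L H (gens P2) (val x) (gens_generate P2)).
have [s2 s2E] := choice (fun x : gens P2 =>
  @eps_surj G L H (gens P1) (val x) (gens_generate P1)).
(* This is [psi] after [phi]. It preserves [eps], so each defect [f^-1 * theta f] lies in the kernel
   and has finite area. *)
pose theta f := subst s1 (subst s2 f).
have thetaM : {morph theta : f g / f * g} by move=> f g; rewrite /theta !substM.
have theta_eps f : eps (f^-1 * theta f) = 1.
  by rewrite epsM epsV /theta !eps_subst // mulVg.
have [K sK] : exists K, forall x, (size (s2 x) <= K)%N.
  by apply: finite_set_type_bound => // [x m k mk|x];
    [move/leq_trans; apply|exists (size (s2 x))].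
have [C RC] : exists C, forall w, rels P1 w ->
    conj_prod (relators P2) C (subst s1 (to_F w)).
  apply: finite_uniform_bound fR1 _ _ => [w m k|w Rw]; first exact: conj_prod_leq.
  apply: kernel_conj_prod; rewrite eps_subst //.
  suff : kernel (@eps G L H (gens P1)) (to_F w) by [].
  by rewrite rels_kernel => S _; apply; exists w.
have [M thetaL] : exists M, forall x b,
    conj_prod (relators P2) M
      ((to_F [:: Gen H x b])^-1 * theta (to_F [:: Gen H x b])).
  apply: finite_set_type_bound => // [x m k mk c b|x].
    exact: conj_prod_leq mk (c b).
  have [m mP] := kernel_conj_prod (theta_eps (to_F [:: Gen H x true])).
  have [k kP] := kernel_conj_prod (theta_eps (to_F [:: Gen H x false])).
  exists (m + k)%N => -[]; first exact: conj_prod_leq (leq_addr _ _) mP.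
  exact: conj_prod_leq (leq_addl _ _) kP.
have thetaW w : conj_prod (relators P2) (M * size w)
    ((to_F w)^-1 * theta (to_F w)).
  elim: w => [|a w IH].
    by rewrite to_F_nil (morph_mul1 thetaM) mulVg; apply: conj_prod1.
  rewrite -cat1s to_F_cat thetaM /= mulnS.
  (* The defect of a product is a conjugate of the first defect times the second, so the costs of
     the letters add up. *)
  have -> : (to_F [:: a] * to_F w)^-1 * (theta (to_F [:: a]) * theta (to_F w)) =
      ((to_F [:: a])^-1 * theta (to_F [:: a])) ^ to_F w *
      ((to_F w)^-1 * theta (to_F w)).
    by rewrite invgM conjgE !mulgA mulgK.
  apply: conj_prodM IH; apply: conj_prodJ.
  case: a => [x b|l h]; first exact: thetaL.
  (* Letters from the subgroups are fixed by [theta] and have trivial defect. *)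
  by rewrite /theta !subst_Per mulVg; apply: conj_prod1.
(* The successor makes the length factor positive, as [subst_size] demands. *)
exists C, K.+1, M => n m /area_boundP b1; apply/area_boundP => W szW W1.
have [W' W'E szW'] := subst_size W (ltn0Sn K) (fun x => leqW (sK x)).
have cW' : conj_prod (relators P2) (C * m) (theta (to_F W)).
  rewrite /theta W'E; apply: conj_prod_morph (b1 W' _ _).
  - exact: substM.
  - by move=> _ [w Rw <-]; apply: RC.
  - by apply: leq_trans szW' _; rewrite leq_mul2l szW orbT.
  - by rewrite -W'E eps_subst.
(* The first factor costs [C * m], the inverse defect at most [M * n]. *)
have -> : to_F W = theta (to_F W) * ((to_F W)^-1 * theta (to_F W))^-1.
  by rewrite invgM invgK mulVKg.
apply: conj_prodM cW' _; apply: conj_prodV; first exact: relators_inv.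
by apply: conj_prod_leq (thetaW W); rewrite leq_mul2l szW orbT.
Qed.

Lemma dehn_leq P n m :
  area_bound P n m -> exists2 k, dehn P n = Some k & (k <= m)%N.
Proof.
move=> b; rewrite /dehn; case: pselect => [ex|[]].
  by case: ex_minnP => k _ km; exists k => //; apply/km/asboolP.
by exists m; apply/asboolP.
Qed.

Lemma dehn_transfer (P1 P2 : rel_presentation H) :
  finite_set (gens P2) -> finite_set (rels P1) -> well_defined (dehn P1) ->
  well_defined (dehn P2) /\
  dominated (finite_values (dehn P2)) (finite_values (dehn P1)).
Proof.
move=> fX2 fR1 wd1; have [C [K [M tr]]] := area_bound_transfer fX2 fR1.
have dehn2 n : exists2 k, dehn P2 n = Some k &
    (k <= C * finite_values (dehn P1) (K * n) + M * n)%N.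
  apply/dehn_leq/tr; have [m mE] := wd1 (K * n)%N.
  by rewrite /finite_values mE; apply: (dehn_smallest P1).1.
split; first by move=> n; have [k kE _] := dehn2 n; exists k.
exists C, K, M => n; have [k kE kle] := dehn2 n.
by rewrite {1}/finite_values kE.
Qed.

End Area.

Theorem theorem2p34 (G : groupType) (Lambda : Type)
    (H : Lambda -> groupClosed G) (P1 P2 : rel_presentation H) :
  finite_presentation P1 ->
  finite_presentation P2 ->
  well_defined (dehn P1) ->
  well_defined (dehn P2) /\
  equivalent (finite_values (dehn P1)) (finite_values (dehn P2)).
Proof.
move=> [fX1 fR1] [fX2 fR2] wd1.
have [wd2 le21] := dehn_transfer fX2 fR1 wd1.
(* Finiteness of the second Dehn function, just obtained, lets the roles be exchanged. *)
by have [_ le12] := dehn_transfer fX1 fR2 wd2.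
Qed.
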